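(* Let $n,m\ge 1$ be integers, let $\Delta_1,\dots,\Delta_m\subseteq[n]$ be cliques covering $[n]$, none of which is contained in another, let $\mathbf g_i:\mathbb R^{|\Delta_i|}\to\mathbb R^{N_i}$ ($i\in[m]$, $N_i\in\mathbb N$) be vectors of polynomials, let $\omega\in\mathbb N$ satisfy $2\omega\ge\max\{1,\deg\mathbf g_1,\dots,\deg\mathbf g_m\}$, and set $d_i=\max\{1,\lceil\tfrac12\deg\mathbf g_i\rceil\}$. Let $\mathbf y=(y_\alpha)_{\alpha\in\mathcal E_{2\omega}}$ be a nonzero real vector such that: (a) for every $i\in\{2,\dots,m\}$ there exists $j\in[i-1]$ such that $\Delta_i\cap(\Delta_1\cup\dots\cup\Delta_{i-1})\subseteq\Delta_j$ (running intersection property); (b) for every $i\in[m]$, $\mathbb M^\omega_{\Delta_i}(\mathbf y)\succeq0$, $\mathbb M^\omega_{\Delta_i}(\mathbf g_i\mathbf y)\succeq0$ and $\operatorname{rank}\mathbb M^\omega_{\Delta_i}(\mathbf y)=\operatorname{rank}\mathbb M^{\omega-d_i}_{\Delta_i}(\mathbf y)$; and for every $i\in\{2,\dots,m\}$ there exists $j\in[i-1]$ with $\Delta_i\cap(\Delta_1\cup\dots\cup\Delta_{i-1})\subseteq\Delta_j$ and $\operatorname{rank}\mathbb M^\omega_{\Delta_i\cap\Delta_j}(\mathbf y)=\operatorname{rank}\mathbb M^{\omega-1}_{\Delta_i\cap\Delta_j}(\mathbf y)$. Let $\mu=\mu^m$ be the atomic representing measure of $\mathbf y$ produced by the assembly procedure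 described in the context. If $\mu'$ is any other atomic representing measure for $\mathbf y$, then $\operatorname{supp}(\mu')\subseteq\operatorname{supp}(\mu)$.
   Context: Notation: $\mathbb N=\{0,1,2,\dots\}$, $[k]=\{1,\dots,k\}$. For $\Delta\subseteq[n]$, $\mathbf x_\Delta=P_\Delta\mathbf x$ is the subvector of $\mathbf x\in\mathbb R^n$ indexed by $\Delta$; for $\Delta'\subseteq\Delta$, $\pi_{\Delta\to\Delta'}:\mathbb R^{|\Delta|}\to\mathbb R^{|\Delta'|}$ is the coordinate projection keeping the entries indexed by $\Delta'$. The $\Delta'$-marginal of a measure on $\mathbb R^{|\Delta|}$ is its pushforward under $\pi_{\Delta\to\Delta'}$. Vector inequalities are element-wise; $\deg\mathbf g_i$ is the maximum degree of the entries of $\mathbf g_i$ (and $0$ if $N_i=0$); $\succeq0$ means positive semidefinite. $\mathcal E_{2\omega}=\bigcup_{i=1}^m\{\alpha\in\mathbb N^n:\ \alpha_k=0\ \forall k\notin\Delta_i,\ \alpha_1+\dots+\alpha_n\le2\omega\}$. $\mathscr L_{\mathbf y}$ is the linear functional on $\operatorname{span}\{\mathbf x^\alpha:\alpha\in\mathcal E_{2\omega}\}$ with $\mathscr L_{\mathbf y}(\mathbf x^\alpha)=y_\alpha$. Moment matrices: for $\Delta\subseteq[n]$ contained in some clique and $0\le d\le\omega$, $\mathbb M^d_\Delta(\mathbf y)$ is indexed by the monomials in $\mathbf x_\Delta$ of degree at most $d$ and has $(p,q)$ entry $\mathscr L_{\mathbf y}(pq)$. Localizing matrices: $\mathbb M^\omega_{\Delta_i}(\mathbf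 g_i\mathbf y)$ is block-diagonal with blocks $\mathbb M^\omega_{\Delta_i}(g_{i,k}\mathbf y)$, $k\in[N_i]$, each indexed by the monomials in $\mathbf x_{\Delta_i}$ of degree at most $\omega-d_i$ with $(p,q)$ entry $\mathscr L_{\mathbf y}(g_{i,k}(\mathbf x_{\Delta_i})\,pq)$. For $\Delta$ contained in a clique, $\mathbf y_\Delta$ is the subvector of $\mathbf y$ of entries $y_\alpha$ with $\alpha$ supported on $\Delta$; a positive Borel measure on $\mathbb R^{|\Delta|}$ represents $\mathbf y_\Delta$ if its moments up to degree $2\omega$ are the entries of $\mathbf y_\Delta$. A positive Borel measure $\mu$ on $\mathbb R^n$ represents $\mathbf y$ if $\int\mathbf x^\alpha d\mu=y_\alpha$ for all $\alpha\in\mathcal E_{2\omega}$. An atomic measure is a finite sum of Dirac measures at distinct points with positive weights. Assembly procedure. Under hypotheses (a), (b), each $\mathbf y_{\Delta_i}$ has a unique representing measure, and it is atomic: $\mu_{\Delta_i}=\sum_{\ell=1}^{r_i}\lambda^i_\ell\delta_{\mathbf z^i_\ell}$ with $r_i=\operatorname{rank}\mathbb M^\omega_{\Delta_i}(\mathbf y)\ge1$, $\lambda^i_\ell>0$ and distinct $\mathbf z^i_\ell\in\{\mathbf z\in\mathbb R^{|\Delta_i|}:\mathbf g_i(\mathbf z)\ge0\}$. Put $U_i=\Delta_1\cup\dots\cup\Delta_i$ and $\mu^1=\mu_{\Delta_1}$. For $i=2,\dots,m$, given $\mu^{i-1}=\sum_{k=1}^s\nu_k\delta_{\mathbf u_k}$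 on $\mathbb R^{|U_{i-1}|}$ (distinct atoms, $\nu_k>0$) whose marginals on $\Delta_1,\dots,\Delta_{i-1}$ are $\mu_{\Delta_1},\dots,\mu_{\Delta_{i-1}}$, choose $j\in[i-1]$ with $\Delta_i\cap U_{i-1}\subseteq\Delta_j$ such that $\mu_{\Delta_i}$ and $\mu_{\Delta_j}$ have the same $\Delta_i\cap\Delta_j$-marginal (such $j$ exists). Then $\mu^{i-1}$ and $\mu_{\Delta_i}$ have a common $\Delta_i\cap\Delta_j$-marginal $\sum_{\tau=1}^t\theta_\tau\delta_{\mathbf v_\tau}$ (distinct $\mathbf v_\tau$, $\theta_\tau>0$). Let $\mathcal A_\tau=\{k\in[s]:\pi_{U_{i-1}\to\Delta_i\cap\Delta_j}\mathbf u_k=\mathbf v_\tau\}$ and $\mathcal B_\tau=\{\ell\in[r_i]:\pi_{\Delta_i\to\Delta_i\cap\Delta_j}\mathbf z^i_\ell=\mathbf v_\tau\}$. For $(k,\ell)\in\mathcal A_\tau\times\mathcal B_\tau$ let $\mathbf w_{\tau,k,\ell}\in\mathbb R^{|U_i|}$ be the unique point whose $U_{i-1}$-projection is $\mathbf u_k$ and whose $\Delta_i$-projection is $\mathbf z^i_\ell$ (well defined since $\Delta_i\cap U_{i-1}=\Delta_i\cap\Delta_j$). Set $$\mu^i=\sum_{\tau=1}^t\sum_{k\in\mathcal A_\tau}\sum_{\ell\in\mathcal B_\tau}\frac{\nu_k\lambda^i_\ell}{\theta_\tau}\,\delta_{\mathbf w_{\tau,k,\ell}}.$$ It has $U_{i-1}$-marginal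 $\mu^{i-1}$ and $\Delta_i$-marginal $\mu_{\Delta_i}$. The output is $\mu=\mu^m$ on $\mathbb R^{|U_m|}=\mathbb R^n$, which represents $\mathbf y$. *)

(* Defs.v *)
(* mpoly must be imported before all_analysis:
   in the opposite order the two sets of notations are incompatible. *)
From HB Require Import structures.
From mathcomp Require Import all_boot all_order all_algebra.
From mathcomp Require Import mpoly.
From mathcomp Require Import all_classical all_reals all_analysis.

Set Implicit Arguments.
Unset Strict Implicit.
Unset Printing Implicit Defensive.

Import Order.TTheory GRing.Theory Num.Theory.
Import numFieldNormedType.Exports.

Local Open Scope classical_set_scope.
Local Open Scope ring_scope.

(* R^d with its Borel sigma-algebra; R^{|D|} for D a set of coordinates is
   Rn R #|D|, its k-th coordinate being the one indexed by enum_val k. *)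
Notation Rn R d := (g_sigma_algebraType (@open 'rV[R]_d)).

Section Coordinates.
Variables (R : realType) (n : nat).
Implicit Types D : {set 'I_n}.

Definition subvector D (x : Rn R n) : Rn R #|D| :=
  colsub (fun k : 'I_#|D| => enum_val k) (x : 'rV[R]_n).

Definition sub_index D D' (sDD : D' \subset D) (k : 'I_#|D'|) : 'I_#|D| :=
  enum_rank_in (fintype.subsetP sDD _ (enum_valP k)) (enum_val k).

Definition coord_proj D D' (sDD : D' \subset D) (z : Rn R #|D|) : Rn R #|D'| :=
  colsub (sub_index sDD) (z : 'rV[R]_#|D|).

Definition marginal D D' (sDD : D' \subset D) (mu : set (Rn R #|D|) -> \bar R) :
    set (Rn R #|D'|) -> \bar R :=
  pushforward mu (coord_proj sDD).

End Coordinates.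

Section Measures.
Variables (R : realType) (d : nat).
Implicit Types mu nu : set (Rn R d) -> \bar R.

(* The values of a measure outside the sigma-algebra carry no meaning. *)
Definition same_measure mu nu := forall A, measurable A -> mu A = nu A.

Definition atomic_sum (s : nat) (c : 'I_s -> R) (z : 'I_s -> Rn R d) :
    set (Rn R d) -> \bar R :=
  fun A => (\sum_(k < s) (c k)%:E * \d_(z k) A)%E.

Definition atomic_decomposition mu (s : nat) (c : 'I_s -> R)
    (z : 'I_s -> Rn R d) : Prop :=
  [/\ forall k, 0 < c k, injective z & same_measure mu (atomic_sum c z)].

Definition atomic mu : Prop :=
  exists s (c : 'I_s -> R) (z : 'I_s -> Rn R d), atomic_decomposition mu c z.

Definition measure_support mu : set (Rn R d) :=
  [set x | forall V : set 'rV[R]_d, open V -> V x -> (0 < mu V)%E].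

End Measures.

Section MomentMatrices.
Variables (R : realType) (n : nat).
(* The pseudo-moments are a function on all exponents, of which only the
   values on the set E_{2 omega} are ever constrained or used. *)
Variable y : 'X_{1..n} -> R.
Implicit Types D : {set 'I_n}.

Definition riesz (p : {mpoly R[n]}) : R := \sum_(a <- msupp p) p@_a * y a.

(* q(x_D) as a polynomial in x *)
Definition in_full_vars D (q : {mpoly R[#|D|]}) : {mpoly R[n]} :=
  q \mPo [tuple 'X_(enum_val k) | k < #|D|].

Definition moment_mx D (d : nat) : 'M[R]_#|{: 'X_{1..#|D| < d.+1}}| :=
  \matrix_(a, b) riesz (in_full_vars
    ('X_[bmnm (enum_val a)] * 'X_[bmnm (enum_val b)])).

(* The degree bound e on the indexing monomials is omega - d_i. *)
Definition localizing_block D (g : {mpoly R[#|D|]}) (e : nat) :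
    'M[R]_#|{: 'X_{1..#|D| < e.+1}}| :=
  \matrix_(a, b) riesz (in_full_vars
    (g * 'X_[bmnm (enum_val a)] * 'X_[bmnm (enum_val b)])).

Definition localizing_mx D N (g : 'I_N -> {mpoly R[#|D|]}) (e : nat) :=
  \mxdiag_(k < N) localizing_block (g k) e.

Definition supported_on D (a : 'X_{1..n}) : Prop :=
  forall k, k \notin D -> a k = 0%N.

Definition represents_on D (t : nat) (mu : set (Rn R #|D|) -> \bar R) : Prop :=
  forall a : 'X_{1..n}, supported_on D a -> (mdeg a <= t)%N ->
    (\int[mu]_z (\prod_(k < #|D|) (z : 'rV[R]__) 0 k ^+ a (enum_val k))%:E
      = (y a)%:E)%E.

End MomentMatrices.

Definition psd (R : realType) (N : nat) (A : 'M[R]_N) : Prop :=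
  A^T = A /\ forall v : 'rV[R]_N, 0 <= (v *m A *m v^T) 0 0.

(* msize p = 1 + deg p *)
Definition maxdeg (R : realType) (d N : nat) (g : 'I_N -> {mpoly R[d]}) : nat :=
  (\max_(k < N) (msize (g k)).-1)%N.

Definition halfdeg (R : realType) (d N : nat) (g : 'I_N -> {mpoly R[d]}) : nat :=
  maxn 1 (uphalf (maxdeg g)).

Section Cliques.
Variables (n m : nat) (Delta : 'I_m -> {set 'I_n}).

(* Cliques are numbered from 0, so this is the union of the first i cliques,
   i.e. of those preceding Delta i. *)
Definition first_cliques (i : nat) : {set 'I_n} :=
  (\bigcup_(k : 'I_m | (k < i)%N) Delta k)%SET.

Lemma clique_sub_first (i : 'I_m) : Delta i \subset first_cliques i.+1.
Proof. exact: (@finset.bigcup_sup _ _ i). Qed.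

Lemma first_cliquesS (i : nat) : first_cliques i \subset first_cliques i.+1.
Proof.
apply/finset.bigcupsP => k ki; apply: (@finset.bigcup_sup _ _ k) => //.
exact: ltn_trans ki (ltnSn i).
Qed.

Lemma cliqueI_sub_first (i j : 'I_m) :
  (j < i)%N -> Delta i :&: Delta j \subset first_cliques i.
Proof.
by move=> ji; apply: fintype.subset_trans (subsetIr _ _) _;
  exact: (@finset.bigcup_sup _ _ j).
Qed.

Definition moment_support (t : nat) (a : 'X_{1..n}) : Prop :=
  exists i : 'I_m, supported_on (Delta i) a /\ (mdeg a <= t)%N.

Definition represents (R : realType) (y : 'X_{1..n} -> R) (t : nat)
    (mu : set (Rn R n) -> \bar R) : Prop :=
  forall a, moment_support t a ->
    (\int[mu]_x (\prod_(k < n) (x : 'rV[R]__) 0 k ^+ a k)%:E = (y a)%:E)%E.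

End Cliques.

(* rho = sum_tau sum_(k in A_tau) sum_(l in B_tau)
           (nu_k * lambda_l / theta_tau) delta_(w tau k l)
   is the measure on R^{|D|}, D = D1 :|: D2, obtained by gluing the atomic
   measures mu1 on R^{|D1|} and mu2 on R^{|D2|} along their common marginal
   on R^{|D0|}, D0 = D1 :&: D2. *)
Definition glued (R : realType) (n : nat) (D D0 D1 D2 : {set 'I_n})
    (s1 : D1 \subset D) (s2 : D2 \subset D)
    (s01 : D0 \subset D1) (s02 : D0 \subset D2)
    (mu1 : set (Rn R #|D1|) -> \bar R) (mu2 : set (Rn R #|D2|) -> \bar R)
    (rho : set (Rn R #|D|) -> \bar R) : Prop :=
  exists (s r t : nat) (nu : 'I_s -> R) (u : 'I_s -> Rn R #|D1|)
    (lambda : 'I_r -> R) (z : 'I_r -> Rn R #|D2|)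
    (theta : 'I_t -> R) (v : 'I_t -> Rn R #|D0|)
    (w : 'I_t -> 'I_s -> 'I_r -> Rn R #|D|),
  [/\ atomic_decomposition mu1 nu u,
      atomic_decomposition mu2 lambda z,
      atomic_decomposition (marginal s01 mu1) theta v /\
      atomic_decomposition (marginal s02 mu2) theta v,
      forall tau k l, coord_proj s01 (u k) = v tau -> coord_proj s02 (z l) = v tau ->
        coord_proj s1 (w tau k l) = u k /\ coord_proj s2 (w tau k l) = z l
    & same_measure rho (fun B =>
        (\sum_(tau < t) \sum_(k < s | coord_proj s01 (u k) == v tau)
           \sum_(l < r | coord_proj s02 (z l) == v tau)
             (nu k * lambda l / theta tau)%:E * \d_(w tau k l) B)%E)].

(* mus i, for 1 <= i <= m, is the measure mu^i on R^{|U_i|}; mus 0 and mus i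
   with i > m are irrelevant. The last clause identifies R^{|U_m|} with R^n. *)
Definition assembled (R : realType) (n m : nat) (Delta : 'I_m -> {set 'I_n})
    (y : 'X_{1..n} -> R) (omega : nat) (mu : set (Rn R n) -> \bar R) : Prop :=
  exists (muD : forall i : 'I_m, {measure set (Rn R #|Delta i|) -> \bar R})
    (mus : forall i : nat,
       {measure set (Rn R #|first_cliques Delta i|) -> \bar R}),
  [/\ forall i : 'I_m,
        represents_on y (2 * omega) (muD i) /\ atomic (muD i),
      forall i : 'I_m, i = 0%N :> nat ->
        same_measure (marginal (clique_sub_first Delta i) (mus i.+1)) (muD i),
      forall i : 'I_m, (0 < i)%N ->
        exists (j : 'I_m) (ji : (j < i)%N),
        [/\ Delta i :&: first_cliques Delta i \subset Delta j,
            same_measure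
              (marginal (subsetIl (Delta i) (Delta j)) (muD i))
              (marginal (subsetIr (Delta i) (Delta j)) (muD j))
          & glued (first_cliquesS Delta i) (clique_sub_first Delta i)
              (cliqueI_sub_first Delta ji) (subsetIl (Delta i) (Delta j))
              (mus i) (muD i) (mus i.+1)]
    & same_measure (pushforward mu (subvector (first_cliques Delta m))) (mus m)].

(* Main.v *)
(* A flat moment matrix determines the atoms of a representing measure: by
   flatness every polynomial agrees on the atoms with one of degree less than
   omega, and a polynomial of degree at most omega vanishes on the atoms of a
   representing measure if and only if its coefficient vector is in the kernel
   of the moment matrix, whichever the measure. Hence every atom x of mu' has
   its Delta_i-projection among the atoms of mu_(Delta_i). By induction on i,
   the U_i-projection of x is then an atom of mu^i: its projections on U_(i-1)
   and Delta_i are atoms that agree on the overlap, so the gluing has an atom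
   projecting to both, and a point of R^(U_i) is determined by these two
   projections. *)

Require Import Defs.
From HB Require Import structures.
From mathcomp Require Import all_boot all_order all_algebra.
From mathcomp Require Import mpoly.
From mathcomp Require Import all_classical all_reals all_analysis.
From mathcomp Require Import measurable_realfun matrix_normedtype.

Set Implicit Arguments.
Unset Strict Implicit.
Unset Printing Implicit Defensive.

Import Order.TTheory GRing.Theory Num.Theory.
Import numFieldNormedType.Exports.

Local Open Scope classical_set_scope.
Local Open Scope ring_scope.

(** * Finite atomic measures on Euclidean space *)

Section RnMeasures.
Variables (R : realType) (d : nat).

Lemma measurable_coord (k : 'I_d) :
  measurable_fun [set: Rn R d] (fun z : Rn R d => (z : 'rV[R]_d) 0 k).
Proof.
apply: (measurability _ (RGenOpens.measurableE R)).
move=> _ [_ [a [b ->] <-]]; rewrite setTI; apply: sub_sigma_algebra.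
by move/continuousP: (@coord_continuous R 1 d 0 k); apply; exact: interval_open.
Qed.

Lemma open_setC_finite (A : set 'rV[R]_d) : finite_set A -> open (~` A).
Proof.
move=> fA; apply: closed_openC; move: A fA.
by apply/accessible_finite_set_closed/hausdorff_accessible; exact: norm_hausdorff.
Qed.

Lemma measurable_colsub_set1 d' (h : 'I_d' -> 'I_d) (v : Rn R d') :
  measurable [set z : Rn R d | colsub h (z : 'rV[R]_d) = v :> 'rV[R]_d'].
Proof.
rewrite (_ : [set z | _] = \bigcap_(k in [set: 'I_d'])
    (fun z : Rn R d => (z : 'rV[R]_d) 0 (h k)) @^-1` [set (v : 'rV[R]_d') 0 k]).
  apply: fin_bigcap_measurable => // k _; rewrite -[_ @^-1` _]setTI.
  by apply: measurable_coord => //; exact: measurable_set1.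
apply/seteqP; split => [z /= zv k _ /=|z /= zv].
  by rewrite -zv mxE.
by apply/rowP => k; rewrite mxE; exact: zv.
Qed.

Lemma measurable_set1_Rn (x : Rn R d) : measurable [set x].
Proof.
rewrite -[X in measurable X]setCK; apply: measurableC; apply: sub_sigma_algebra.
exact/open_setC_finite/finite_set1.
Qed.

Variables (s : nat) (c : 'I_s -> R) (z : 'I_s -> Rn R d).
Hypothesis c_gt0 : forall k, 0 < c k.

Lemma atomic_sum_gt0 (A : set (Rn R d)) :
  (0 < atomic_sum c z A)%E <-> exists k, A (z k).
Proof.
split=> [|[k Ak]].
  apply: contraPP => /forallNP Az; rewrite /atomic_sum big1 ?ltxx// => k _.
  by rewrite diracE memNset// mule0.
rewrite /atomic_sum (bigD1 k)//= diracE mem_set// mule1.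
rewrite (@lt_le_trans _ _ (c k)%:E) ?lte_fin// leeDl//; apply: sume_ge0 => l _.
by rewrite mule_ge0// lee_fin ltW.
Qed.

(** [msum] sums a sequence indexed by [nat], so the weighted Dirac masses are padded with zero
    measures. *)
Let weighted_dirac (i : nat) : {measure set (Rn R d) -> \bar R} :=
  if insub i is Some k then mscale (NngNum (ltW (c_gt0 k))) \d_(z k) else mzero.

Lemma ge0_integral_atomic (mu : {measure set (Rn R d) -> \bar R})
    (f : Rn R d -> R) : same_measure mu (atomic_sum c z) ->
    measurable_fun setT f -> (forall x, 0 <= f x) ->
  (\int[mu]_x (f x)%:E = (\sum_(k < s) c k * f (z k))%:E)%E.
Proof.
move=> muE mf f0.
have mEf : measurable_fun setT (fun x => (f x)%:E) by exact/measurable_EFinP.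
have Ef0 x : setT x -> (0 <= (f x)%:E)%E by rewrite lee_fin.
rewrite (@eq_measure_integral _ _ _ _ (msum weighted_dirac s)).
  rewrite ge0_integral_measure_sum// -sumEFin; apply: eq_bigr => k _.
  rewrite /weighted_dirac valK ge0_integral_mscale// integral_dirac//.
  by rewrite diracT mul1e.
move=> A mA _; rewrite muE//; apply: eq_bigr => k _.
by rewrite /weighted_dirac valK.
Qed.

(** The integrals of the positive and negative parts of [f] are finite sums of reals, so their
    difference is well defined for every measurable [f]. *)
Lemma integral_atomic (mu : {measure set (Rn R d) -> \bar R})
    (f : Rn R d -> R) : same_measure mu (atomic_sum c z) ->
    measurable_fun setT f ->
  (\int[mu]_x (f x)%:E = (\sum_(k < s) c k * f (z k))%:E)%E.
Proof.
move=> muE mf; rewrite integralE.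
rewrite (funerpos f) (funerneg f) !ge0_integral_atomic//.
- rewrite -EFinB -sumrB; congr EFin; apply: eq_bigr => k _; rewrite -mulrBr.
  by rewrite -[in RHS](funrposBneg f).
- exact: measurable_funrneg.
- exact: measurable_funrpos.
Qed.

(** The complement of the atoms is open, as they are finitely many, and has measure zero, so it
    contains no point of the support. *)
Lemma measure_support_atom (mu : {measure set (Rn R d) -> \bar R}) (x : Rn R d) :
  same_measure mu (atomic_sum c z) -> measure_support mu x -> exists k, x = z k.
Proof.
move=> muE mux; apply: contrapT => /forallNP xz.
have oV : open (~` range z : set 'rV[R]_d).
  exact/open_setC_finite/finite_image/finite_finset.
have := mux _ oV; rewrite muE; last exact: sub_sigma_algebra.
move=> /(_ _)/atomic_sum_gt0[|k]; first by case=> k _ zk; exact: (xz k).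
by apply; exists k.
Qed.

End RnMeasures.

(** * Flat moment matrices and the atoms of representing measures *)

Section FlatHankel.
Variables (R : realType) (d : nat).
Implicit Types (L : 'X_{1..d} -> R) (a b : 'X_{1..d}).

Definition monomial_eval a (x : 'rV[R]_d) : R := \prod_(k < d) x 0 k ^+ a k.

(** A Vandermonde matrix: its row space consists of the vectors of values at the points [z] of the
    polynomials of degree at most [e]. *)
Definition eval_mx (e s : nat) (z : 'I_s -> 'rV[R]_d) :
    'M[R]_(#|{: 'X_{1..d < e.+1}}|, s) :=
  \matrix_(a, k) monomial_eval (bmnm (enum_val a)) (z k).

Definition hankel_mx L (e : nat) : 'M[R]_#|{: 'X_{1..d < e.+1}}| :=
  \matrix_(a, b) L (bmnm (enum_val a) + bmnm (enum_val b))%MM.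

(** The points may repeat, as happens for projected atoms and for merged lists of atoms. *)
Definition discrete_moments L (t s : nat) (c : 'I_s -> R)
    (z : 'I_s -> 'rV[R]_d) : Prop :=
  forall a, (mdeg a <= t)%N -> L a = \sum_(k < s) c k * monomial_eval a (z k).

Lemma monomial_evalD a b x :
  monomial_eval (a + b)%MM x = monomial_eval a x * monomial_eval b x.
Proof.
by rewrite /monomial_eval -big_split; apply: eq_bigr => k _; rewrite mnmDE exprD.
Qed.

Lemma monomial_eval0 x : monomial_eval 0%MM x = 1.
Proof. by rewrite /monomial_eval big1// => k _; rewrite mnm0E expr0. Qed.

Lemma monomial_evalU (j : 'I_d) x : monomial_eval U_(j)%MM x = x 0 j.
Proof.
rewrite /monomial_eval (bigD1 j)//= mnm1E eqxx expr1 big1 ?mulr1// => k kj.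
by rewrite mnm1E eq_sym (negbTE kj) expr0.
Qed.

Lemma eval_mx_monomial e s (z : 'I_s -> 'rV[R]_d) a : (mdeg a <= e)%N ->
  (\row_k monomial_eval a (z k) <= eval_mx e z)%MS.
Proof.
rewrite -ltnS => ae; pose i := enum_rank (BMultinom ae).
rewrite (_ : \row_k _ = row i (eval_mx e z)); first exact: row_sub.
by apply/rowP => k; rewrite !mxE enum_rankK.
Qed.

Lemma eval_mx_leq e e' s (z : 'I_s -> 'rV[R]_d) : (e <= e')%N ->
  (eval_mx e z <= eval_mx e' z)%MS.
Proof.
move=> ee'; apply/row_subP => i.
rewrite (_ : row i _ = \row_k monomial_eval (bmnm (enum_val i)) (z k)); last first.
  by apply/rowP => k; rewrite !mxE.
by apply: eval_mx_monomial; apply: leq_trans ee'; rewrite -ltnS bmdeg.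
Qed.

Lemma hankel_mxE L e s (c : 'I_s -> R) z : discrete_moments L (2 * e) c z ->
  hankel_mx L e = eval_mx e z *m diag_mx (\row_k c k) *m (eval_mx e z)^T.
Proof.
move=> Lz; apply/matrixP => a b; rewrite !mxE Lz; last first.
  by rewrite mdegD mul2n -addnn leq_add// -ltnS bmdeg.
apply: eq_bigr => k _.
by rewrite mul_mx_diag !mxE monomial_evalD mulrA [c k * _]mulrC.
Qed.

(** If [u] holds the coefficients of [p], then [u *m hankel_mx L e *m u^T] is the sum of the
    [c k * p(z k)^2]; with positive weights it vanishes only if [p] vanishes at every [z k]. *)
Lemma hankel_mx_ker L e s (c : 'I_s -> R) z (u : 'rV_ _) :
  (forall k, 0 < c k) -> discrete_moments L (2 * e) c z ->
  (u *m hankel_mx L e == 0) = (u *m eval_mx e z == 0).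
Proof.
move=> c0 /hankel_mxE ->; apply/eqP/eqP => [uM|uE]; last first.
  by rewrite !mulmxA uE !mul0mx.
have : (u *m (eval_mx e z *m diag_mx (\row_k c k) *m (eval_mx e z)^T) *m u^T) 0 0
    = 0 by rewrite uM mul0mx mxE.
rewrite !mulmxA -mulmxA -trmx_mul; set v := u *m eval_mx e z.
rewrite mul_mx_diag mxE.
have v2 k : (\matrix_(i, j) (v i j * (\row_k c k) 0 j)) 0 k * v^T k 0
    = c k * v 0 k ^+ 2.
  by rewrite !mxE expr2 mulrAC mulrC.
under eq_bigr do rewrite v2.
move=> /psumr_eq0P vk; apply/rowP => k; rewrite [RHS]mxE.
have /eqP := vk (fun k _ => mulr_ge0 (ltW (c0 k)) (sqr_ge0 _)) k isT.
by rewrite mulf_eq0 gt_eqF//= sqrf_eq0 => /eqP.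
Qed.

Lemma rank_hankel_mx L e s (c : 'I_s -> R) z :
  (forall k, 0 < c k) -> discrete_moments L (2 * e) c z ->
  \rank (hankel_mx L e) = \rank (eval_mx e z).
Proof.
move=> c0 Lz.
have kerE : \rank (kermx (hankel_mx L e)) = \rank (kermx (eval_mx e z)).
  apply/eqmx_rank/andP; split; apply/row_subP => i; apply/sub_kermxP/eqP.
    by rewrite -(hankel_mx_ker _ c0 Lz) -row_mul mulmx_ker row0.
  by rewrite (hankel_mx_ker _ c0 Lz) -row_mul mulmx_ker row0.
rewrite -[LHS](subKn (rank_leq_row _)) -mxrank_ker kerE mxrank_ker.
by rewrite subKn ?rank_leq_row.
Qed.

Lemma discrete_momentsW L t t' s (c : 'I_s -> R) z : (t <= t')%N ->
  discrete_moments L t' c z -> discrete_moments L t c z.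
Proof. by move=> tt' Lz a /leq_trans /(_ tt'); exact: Lz. Qed.

(** The row space of [eval_mx e z] lies in that of [eval_mx f z], and equal ranks force equality: on
    the atoms, every polynomial of degree at most [f] agrees with one of degree at most [e]. *)
Lemma flat_eval_mx L e f s (c : 'I_s -> R) z : (e <= f)%N ->
  (forall k, 0 < c k) -> discrete_moments L (2 * f) c z ->
  \rank (hankel_mx L f) = \rank (hankel_mx L e) ->
  (eval_mx f z <= eval_mx e z)%MS.
Proof.
move=> ef c0 Lz; rewrite (rank_hankel_mx c0 Lz).
have Lz' : discrete_moments L (2 * e) c z.
  by apply: discrete_momentsW Lz; rewrite leq_mul2l.
rewrite (rank_hankel_mx c0 Lz') => rk.
by rewrite -(mxrank_leqif_sup (eval_mx_leq z ef)) rk.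
Qed.

(** Multiplication by [X_j] raises the degree to at most [e.+1], and flatness lowers it back to
    [e]. *)
Lemma eval_mx_mul_coord e s (z : 'I_s -> 'rV[R]_d) (j : 'I_d) (v : 'rV_s) :
  (eval_mx e.+1 z <= eval_mx e z)%MS -> (v <= eval_mx e z)%MS ->
  (\row_k (v 0 k * z k 0 j)%R <= eval_mx e z)%MS.
Proof.
move=> flat /submxP[u ->].
rewrite (_ : \row_k _ = u *m \matrix_(a, k)
    monomial_eval (bmnm (enum_val a) + U_(j))%MM (z k)); last first.
  apply/rowP => k; rewrite !mxE mulr_suml; apply: eq_bigr => a _.
  by rewrite !mxE monomial_evalD monomial_evalU mulrA.
apply/mulmx_sub/row_subP => a; apply: submx_trans flat.
rewrite (_ : row a _ = \row_k monomial_eval (bmnm (enum_val a) + U_(j))%MM (z k)).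
  by apply: eval_mx_monomial; rewrite mdegD mdeg1 addn1 bmdeg.
by apply/rowP => k; rewrite !mxE.
Qed.

(** A pair [(j, a)] stands for the factor [X_j - a]. Starting from the constant 1, factors are
    multiplied in one at a time, so the product may have any degree. *)
Lemma flat_eval_mx_prod e s (z : 'I_s -> 'rV[R]_d) (p : seq ('I_d * R)) :
  (eval_mx e.+1 z <= eval_mx e z)%MS ->
  (\row_k (\prod_(q <- p) (z k 0 q.1 - q.2))%R <= eval_mx e z)%MS.
Proof.
move=> flat; elim: p => [|q p IHp].
  rewrite (_ : \row_k _ = \row_k monomial_eval 0%MM (z k)).
    by apply: eval_mx_monomial; rewrite mdeg0.
  by apply/rowP => k; rewrite !mxE big_nil monomial_eval0.
set v := \row_k _ in IHp.
rewrite (_ : \row_k _ = \row_k (v 0 k * z k 0 q.1) + (- q.2) *: v).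
  by apply: addmx_sub; [exact: eval_mx_mul_coord|exact: scalemx_sub].
by apply/rowP => k; rewrite !mxE big_cons mulrDl mulrC.
Qed.

(* On the atoms [w] of both measures, the polynomial
   [prod_l (X_(j l) - z_l (j l))] agrees with one of degree at most [e]; as it
   vanishes at the [z_l], it lies in the kernel of the Hankel matrix and hence
   vanishes at the [x_k] as well. *)
Lemma flat_atoms L e f r s (b : 'I_r -> R) z (c : 'I_s -> R) x : (e < f)%N ->
  (forall k, 0 < b k) -> discrete_moments L (2 * f) b z ->
  (forall k, 0 < c k) -> discrete_moments L (2 * f) c x ->
  \rank (hankel_mx L f) = \rank (hankel_mx L e) ->
  forall k, exists l, x k = z l.
Proof.
move=> ef b0 Lz c0 Lx rk k.
apply: contrapT => /forallNP xz.
(* The coordinate [j l] separates [x k] from [z l], so the product of the [X_(j l) - z l 0 (j l)] is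
   nonzero at [x k]. *)
have /choice[j jP] : forall l, exists j, x k 0 j != z l 0 j.
  move=> l; apply: contrapT => /forallNP H; apply: (xz l).
  by apply/rowP => j; apply/eqP; have /negP := H j; rewrite negbK.
pose w (i : 'I_(r + s)) := match fintype.split i with inl i => z i | inr i => x i end.
pose h (i : 'I_(r + s)) := (match fintype.split i with inl i => b i | inr i => c i end) / 2.
have wl i : w (lshift s i) = z i by rewrite /w (unsplitK (inl i)).
have wr i : w (rshift r i) = x i by rewrite /w (unsplitK (inr i)).
have h0 i : 0 < h i by rewrite /h divr_gt0//; case: fintype.split.
(* [h], [w] is the average of the two measures: it has the same moments. *)
have Lw : discrete_moments L (2 * f) h w.
  move=> a af; rewrite big_split_ord/=.
  under eq_bigr do rewrite wl /h (unsplitK (inl _)) mulrAC.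
  under [X in _ + X]eq_bigr do rewrite wr /h (unsplitK (inr _)) mulrAC.
  by rewrite -!mulr_suml -Lz// -Lx// -splitr.
(* The rank hypothesis concerns [L] alone, so it also gives flatness for the averaged measure. *)
have flat : (eval_mx e.+1 w <= eval_mx e w)%MS.
  apply: submx_trans (eval_mx_leq _ ef) _.
  exact: flat_eval_mx (ltnW ef) h0 Lw rk.
have := flat_eval_mx_prod [seq (j l, z l 0 (j l)) | l <- enum 'I_r] flat.
move=> /submxP[u /rowP uE].
have mono i l : (u *m eval_mx e w) 0 i =
    \sum_a u 0 a * monomial_eval (bmnm (enum_val a)) (w i).
  by rewrite mxE; apply: eq_bigr => a _; rewrite mxE.
have ef2 : (2 * e <= 2 * f)%N by rewrite leq_mul2l ltnW.
have uz : u *m eval_mx e z == 0.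
  apply/eqP/rowP => l; have := uE (lshift s l).
  rewrite mxE wl big_map (bigD1_seq l) ?mem_enum ?enum_uniq//= subrr mul0r.
  move=> /esym u0; rewrite mxE [RHS]mxE -[RHS]u0 mxE.
  by apply: eq_bigr => a _; rewrite !mxE wl.
have : u *m eval_mx e x == 0.
  rewrite -(hankel_mx_ker _ c0 (discrete_momentsW ef2 Lx)).
  by rewrite (hankel_mx_ker _ b0 (discrete_momentsW ef2 Lz)).
move=> /eqP/rowP/(_ k); rewrite [RHS]mxE; have := uE (rshift r k).
rewrite mxE wr big_map => xk; apply/eqP.
rewrite (_ : (u *m eval_mx e x) 0 k = (u *m eval_mx e w) 0 (rshift r k)).
  rewrite -xk prodf_seq_neq0; apply/allP => l _ /=.
  by rewrite subr_eq0 jP.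
by rewrite !mxE; apply: eq_bigr => a _; rewrite !mxE wr.
Qed.

End FlatHankel.

(** * Passing between all coordinates and those of a clique *)

Section CoordinateMoments.
Variables (R : realType) (n : nat).
Implicit Types D : {set 'I_n}.

Lemma enum_val_sub_index D D' (sDD : D' \subset D) k :
  enum_val (sub_index sDD k) = enum_val k.
Proof.
by rewrite enum_rankK_in //; exact: (fintype.subsetP sDD _ (enum_valP k)).
Qed.

Lemma coord_proj_subvector D D' (sDD : D' \subset D) (x : Rn R n) :
  coord_proj sDD (subvector D x) = subvector D' x.
Proof. by apply/rowP => k; rewrite !mxE enum_val_sub_index. Qed.

Lemma coord_proj_cover_inj D D1 D2 (s1 : D1 \subset D) (s2 : D2 \subset D)
    (w w' : Rn R #|D|) : D \subset D1 :|: D2 ->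
  coord_proj s1 w = coord_proj s1 w' -> coord_proj s2 w = coord_proj s2 w' ->
  w = w'.
Proof.
move=> sD /rowP e1 /rowP e2; apply/rowP => p.
have ext D' (s' : D' \subset D) : enum_val p \in D' ->
    (forall k, (coord_proj s' w : 'rV_ _) 0 k = (coord_proj s' w' : 'rV_ _) 0 k) ->
    (w : 'rV_ _) 0 p = (w' : 'rV_ _) 0 p.
  move=> pD' /(_ (enum_rank_in pD' (enum_val p))); rewrite !mxE.
  rewrite (_ : sub_index _ _ = p)//; apply: enum_val_inj.
  by rewrite enum_val_sub_index enum_rankK_in.
have := fintype.subsetP sD _ (enum_valP p); rewrite inE => /orP[] pD.
- exact: ext pD e1.
- exact: ext pD e2.
Qed.

Lemma subvectorT_inj D : D = [set: 'I_n]%SET -> injective (@subvector R n D).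
Proof.
move=> DT x x' /rowP xx'; apply/rowP => k.
have kD : k \in D by rewrite DT inE.
by have := xx' (enum_rank_in kD k); rewrite !mxE enum_rankK_in.
Qed.

(** Padding by zero outside [D] turns the part of [y] on [D] into a moment sequence in [#|D|]
    variables, to which the results on [hankel_mx] apply. *)
Definition extend_exponent D (a : 'X_{1..#|D|}) : 'X_{1..n} :=
  (\sum_(k < #|D|) U_(enum_val k) *+ a k)%MM.

Lemma extend_exponentE D (a : 'X_{1..#|D|}) k :
  extend_exponent a (enum_val k) = a k.
Proof.
rewrite /extend_exponent mnm_sumE (bigD1 k)//= mulmnE mnm1E eqxx mul1n.
rewrite big1 ?addn0// => l lk; rewrite mulmnE mnm1E.
by rewrite (inj_eq enum_val_inj) (negbTE lk).
Qed.

Lemma extend_exponent_supported D (a : 'X_{1..#|D|}) :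
  supported_on D (extend_exponent a).
Proof.
move=> i iD; rewrite /extend_exponent mnm_sumE big1// => k _.
rewrite mulmnE mnm1E (_ : _ == i = false)//.
by apply: contraNF iD => /eqP <-; exact: enum_valP.
Qed.

Lemma mdeg_extend_exponent D (a : 'X_{1..#|D|}) :
  mdeg (extend_exponent a) = mdeg a.
Proof.
rewrite /extend_exponent mdeg_sum [RHS]mdegE; apply: eq_bigr => k _.
by rewrite mdegMn mdeg1 mul1n.
Qed.

Lemma riesz_in_full_varsX (y : 'X_{1..n} -> R) D (a : 'X_{1..#|D|}) :
  riesz y (in_full_vars 'X_[a]) = y (extend_exponent a).
Proof.
rewrite /in_full_vars comp_mpolyX.
under eq_bigr do rewrite tnth_mktuple.
by rewrite mprodXnE /riesz msuppX big_seq1 mcoeffX eqxx mul1r.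
Qed.

Lemma moment_mx_hankel (y : 'X_{1..n} -> R) D e :
  moment_mx y D e = hankel_mx (fun a : 'X_{1..#|D|} => y (extend_exponent a)) e.
Proof.
by apply/matrixP => a b; rewrite !mxE -mpolyXD riesz_in_full_varsX.
Qed.

Lemma monomial_eval_subvector D (a : 'X_{1..#|D|}) (x : Rn R n) :
  monomial_eval (extend_exponent a) x = monomial_eval a (subvector D x).
Proof.
rewrite /monomial_eval (bigID (mem D))/= [X in _ * X]big1 ?mulr1.
  rewrite big_enum_val; apply: eq_bigr => k _.
  by rewrite mxE extend_exponentE.
by move=> k /extend_exponent_supported ->; rewrite expr0.
Qed.

Lemma measurable_monomial_eval d (a : 'X_{1..d}) :
  measurable_fun [set: Rn R d] (fun x : Rn R d => monomial_eval a x).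
Proof.
by apply: measurable_prod => k _; apply: measurable_funX; exact: measurable_coord.
Qed.

Lemma represents_on_moments (y : 'X_{1..n} -> R) D t s c (z : 'I_s -> Rn R #|D|)
    (mu : {measure set (Rn R #|D|) -> \bar R}) :
  represents_on y t mu -> atomic_decomposition mu c z ->
  discrete_moments (fun a : 'X_{1..#|D|} => y (extend_exponent a)) t c z.
Proof.
move=> muy [c0 _ muE] a at_; apply: EFin_inj.
rewrite -(integral_atomic c0 muE (measurable_monomial_eval a)).
rewrite -muy; [|exact: extend_exponent_supported|by rewrite mdeg_extend_exponent].
by apply: eq_integral => z' _; under eq_bigr do rewrite extend_exponentE.
Qed.

(** A monomial supported on [Delta i] sees only the projections of the atoms. Keeping their list,
    possibly with repetitions, avoids merging them into a marginal. *)
Lemma represents_moments m (Delta : 'I_m -> {set 'I_n}) (y : 'X_{1..n} -> R)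
    t s c (x : 'I_s -> Rn R n) (mu : {measure set (Rn R n) -> \bar R}) i :
  represents Delta y t mu -> atomic_decomposition mu c x ->
  discrete_moments (fun a : 'X_{1..#|Delta i|} => y (extend_exponent a)) t c
    (fun k => subvector (Delta i) (x k)).
Proof.
move=> muy [c0 _ muE] a at_; apply: EFin_inj.
under eq_bigr do rewrite -monomial_eval_subvector.
rewrite -(integral_atomic c0 muE (measurable_monomial_eval _)) -muy//.
by exists i; split; [exact: extend_exponent_supported|rewrite mdeg_extend_exponent].
Qed.

End CoordinateMoments.

(** * Atoms of a glued measure *)

Section Gluing.
Variables (R : realType) (n : nat).

Lemma coord_proj_set1_gt0 (D D' : {set 'I_n}) (sDD : D' \subset D)
    (mu : {measure set (Rn R #|D|) -> \bar R}) (z : Rn R #|D|) :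
  (0 < mu [set z])%E -> (0 < marginal sDD mu [set coord_proj sDD z])%E.
Proof.
move=> muz; apply: lt_le_trans muz _; apply: le_measure; rewrite ?inE.
- exact: measurable_set1_Rn.
- exact: (measurable_colsub_set1 (sub_index sDD)).
- by move=> _ ->.
Qed.

(** Positive mass of a singleton characterizes atoms independently of the decomposition; [glued] and
    [assembled] each provide only some decomposition. *)
Lemma atomic_set1_gt0 d (mu : set (Rn R d) -> \bar R) s (c : 'I_s -> R) z x :
  atomic_decomposition mu c z ->
  (0 < mu [set x])%E <-> exists k, z k = x.
Proof.
move=> [c0 _ muE]; rewrite muE; first exact: atomic_sum_gt0.
exact: measurable_set1_Rn.
Qed.

(** The two projected atoms agree on [D0], so the gluing has a term for this pair. Its point is
    [subvector D x], its weight is positive, and no other term is negative. *)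
Lemma glued_set1_gt0 (D D0 D1 D2 : {set 'I_n})
    (s1 : D1 \subset D) (s2 : D2 \subset D)
    (s01 : D0 \subset D1) (s02 : D0 \subset D2)
    (mu1 : {measure set (Rn R #|D1|) -> \bar R})
    (mu2 : {measure set (Rn R #|D2|) -> \bar R})
    (rho : set (Rn R #|D|) -> \bar R) (x : Rn R n) :
  D \subset D1 :|: D2 -> glued s1 s2 s01 s02 mu1 mu2 rho ->
  (0 < mu1 [set subvector D1 x])%E -> (0 < mu2 [set subvector D2 x])%E ->
  (0 < rho [set subvector D x])%E.
Proof.
move=> sD [s [r [t [nu [u [la [z [th [v [w [d1 d2 [d01 _] wP ->]]]]]]]]]]];
  last exact: measurable_set1_Rn.
move=> x1 x2.
have [k uk] := (atomic_set1_gt0 _ d1).1 x1.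
have [l zl] := (atomic_set1_gt0 _ d2).1 x2.
(* The projection of an atom of [mu1] has positive mass in the marginal on [D0], hence is some
   [v tau]. *)
have [tau vtau] : exists tau, v tau = subvector D0 x.
  apply/(atomic_set1_gt0 _ d01).
  by rewrite -(coord_proj_subvector s01); exact: coord_proj_set1_gt0.
have uv : coord_proj s01 (u k) = v tau by rewrite uk coord_proj_subvector.
have zv : coord_proj s02 (z l) = v tau by rewrite zl coord_proj_subvector.
have [w1 w2] := wP _ _ _ uv zv.
have wx : w tau k l = subvector D x.
  by apply: (coord_proj_cover_inj sD); rewrite ?w1 ?w2 coord_proj_subvector.
have [[nu0 _ _] [la0 _ _] [th0 _ _]] := And3 d1 d2 d01.
have ge0 tau' k' l' : (0 <= (nu k' * la l' / th tau')%:E *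
    \d_(w tau' k' l') [set subvector D x])%E.
  by rewrite mule_ge0// lee_fin ltW// divr_gt0// mulr_gt0.
rewrite (bigD1 tau)//= (bigD1 k) ?uv//= (bigD1 l) ?zv//= -!addeA.
rewrite diracE wx mem_set// mule1.
rewrite (@lt_le_trans _ _ (nu k * la l / th tau)%:E)//.
  by rewrite lte_fin divr_gt0// mulr_gt0.
rewrite leeDl// !adde_ge0//; apply: sume_ge0 => *; do ?apply: sume_ge0 => *;
  exact: ge0.
Qed.

End Gluing.

(** * Atoms of [mu'] are atoms of the assembled measure *)

Theorem proposition4p1 (R : realType) (n m : nat)
  (n_gt0 : (0 < n)%N) (m_gt0 : (0 < m)%N)
  (Delta : 'I_m -> {set 'I_n})
  (Delta_cover : (\bigcup_(i < m) Delta i)%SET = [set: 'I_n]%SET)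
  (Delta_antichain : forall i j : 'I_m, i != j -> ~~ (Delta i \subset Delta j))
  (N : 'I_m -> nat)
  (g : forall i : 'I_m, 'I_(N i) -> {mpoly R[#|Delta i|]})
  (omega : nat)
  (omega_ge1 : (1 <= 2 * omega)%N)
  (omega_ge_deg : forall i : 'I_m, (maxdeg (@g i) <= 2 * omega)%N)
  (y : 'X_{1..n} -> R)
  (y_neq0 : exists a, moment_support Delta (2 * omega) a /\ y a != 0)
  (running_intersection : forall i : 'I_m, (0 < i)%N ->
     exists2 j : 'I_m, (j < i)%N
       & Delta i :&: first_cliques Delta i \subset Delta j)
  (y_psd : forall i : 'I_m,
     [/\ psd (moment_mx y (Delta i) omega),
         psd (localizing_mx y (@g i) (omega - halfdeg (@g i)))
       & \rank (moment_mx y (Delta i) omega)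
         = \rank (moment_mx y (Delta i) (omega - halfdeg (@g i)))])
  (y_flat_overlap : forall i : 'I_m, (0 < i)%N ->
     exists j : 'I_m,
     [/\ (j < i)%N,
         Delta i :&: first_cliques Delta i \subset Delta j
       & \rank (moment_mx y (Delta i :&: Delta j) omega)
         = \rank (moment_mx y (Delta i :&: Delta j) (omega - 1))])
  (mu : {measure set (Rn R n) -> \bar R})
  (mu_assembled : assembled Delta y omega mu)
  (mu' : {measure set (Rn R n) -> \bar R})
  (mu'_atomic : atomic mu')
  (mu'_represents : represents Delta y (2 * omega) mu') :
  measure_support mu' `<=` measure_support mu.
Proof.
have [s [c [x mu'E]]] := mu'_atomic; have [c0 _ mu'sum] := mu'E.
move: mu_assembled => [muD [mus [muDP base glue final]]].
have atomD i k : (0 < muD i [set subvector (Delta i) (x k)])%E.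
  have [muDy [r [b [z zP]]]] := muDP i; have [b0 _ _] := zP.
  apply/(atomic_set1_gt0 _ zP).
  (* [flat_atoms] requires a strict drop in degree: [halfdeg] is at least 1 and [omega] is positive,
     so the truncated subtraction is strict. *)
  have half0 : (0 < halfdeg (@g i))%N by rewrite leq_max.
  have omega0 : (0 < omega)%N by move: omega_ge1; rewrite muln_gt0.
  have lt_omega : (omega - halfdeg (@g i) < omega)%N.
    by rewrite ltn_subrL half0.
  have [_ _] := y_psd i; rewrite !moment_mx_hankel => flat.
  have [l xz] := flat_atoms lt_omega b0 (represents_on_moments muDy zP)
    c0 (represents_moments (i := i) mu'_represents mu'E) flat k.
  by exists l.
have atomU k i : (0 < i <= m)%N ->
    (0 < mus i [set subvector (first_cliques Delta i) (x k)])%E.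
  (* Cliques are numbered from 0 but [mus] from 1: the clique [i'] of index [i] is glued to [mus i]
     to give [mus i.+1]. For [i = 0] nothing is glued and [base] applies. *)
  elim: i => // i IHi /andP[_ im]; pose i' := Ordinal im.
  have := atomD i' k; case: (posnP i) => [i0|i_gt0].
    rewrite -(base i' i0); last exact: measurable_set1_Rn.
    rewrite /marginal /pushforward (_ : _ @^-1` _ =
        [set subvector (first_cliques Delta i.+1) (x k)])//.
    (* Here the union is the first clique alone; taking it twice as a cover lets
       [coord_proj_cover_inj] show that the projection is injective. *)
    have sU : first_cliques Delta i.+1 \subset Delta i' :|: Delta i'.
      rewrite finset.setUid; apply/finset.bigcupsP => j.
      rewrite ltnS {1}i0 leqn0 => /eqP j0.
      by rewrite (_ : j = i')//; apply/val_inj; rewrite /= j0 i0.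
    apply/seteqP; split => w /=.
      rewrite -(coord_proj_subvector (clique_sub_first Delta i')) => wx.
      exact: (coord_proj_cover_inj sU wx wx).
    by move=> ->; rewrite coord_proj_subvector.
  have [j [ji [_ _ gl]]] := glue i' i_gt0; apply: glued_set1_gt0 gl _.
    apply/finset.bigcupsP => l; rewrite ltnS leq_eqVlt => /orP[/eqP li|li].
      by rewrite (_ : l = i') ?finset.subsetUr//; exact: val_inj.
    by apply: subsetU; apply/orP; left; exact: (@finset.bigcup_sup _ _ l).
  by apply: IHi; rewrite i_gt0 ltnW.
move=> _ /(measure_support_atom c0 mu'sum)[k ->] V oV Vx.
have UT : first_cliques Delta m = [set: 'I_n]%SET.
  by rewrite -Delta_cover; apply: eq_bigl => j; rewrite ltn_ord.
(* As the cliques cover all coordinates, [subvector] is injective and the preimage of the projected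
   atom is a singleton. *)
have mux : (0 < mu [set x k])%E.
  have := atomU k m; rewrite m_gt0 leqnn => /(_ isT).
  rewrite -final; last exact: measurable_set1_Rn.
  rewrite /pushforward (_ : _ @^-1` _ = [set x k])//.
  apply/seteqP; split => w /=; last by move=> ->.
  exact: subvectorT_inj.
apply: lt_le_trans mux _; apply: le_measure; rewrite ?inE.
- exact: measurable_set1_Rn.
- exact: sub_sigma_algebra.
- by move=> _ ->.
Qed.
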